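(* The number of standard Young tableaux of battery shape $[(11^7),1,6]$ is equal to $$2^{5}\cdot 3^{2}\cdot 5^{2}\cdot 11\cdot 13\cdot 17^{2}\cdot 19^{3}\cdot 23^{2}\cdot 29\cdot 31\cdot 37^{2}\cdot 41\cdot 3361178017\cdot 2839893182041.$$
   Context: $(11^7)$ denotes the partition with $7$ parts all equal to $11$, whose Young diagram is a rectangle with $7$ rows and $11$ columns. The battery shape $[(11^7),1,6]$ (of size $78$) is obtained from this rectangle by adding one cell directly above the top cell of the $6$-th column; i.e. it consists of the cells $(i,j)$ with $1\le i\le 7$, $1\le j\le 11$, together with the cell $(0,6)$, where the first coordinate is the row (increasing downwards) and the second the column. A standard Young tableau of this shape is a bijection from its set of cells to $\{1,\dots,78\}$ such that entries increase from left to right in each row and from top to bottom in each column (including the added cell). *)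

(* Defs.v *)
From mathcomp Require Import all_boot.

Set Implicit Arguments.
Unset Strict Implicit.
Unset Printing Implicit Defensive.

(* A cell is a pair (row, column), with rows increasing downwards. *)
Definition cell := (nat * nat)%type.

(* The battery shape [(n^m), 1, k]: the m x n rectangle, with rows 1..m and
   columns 1..n, and one further cell in row 0 on top of column k. *)
Definition battery (m n k : nat) : seq cell :=
  (0, k) :: [seq (i, j) | i <- iota 1 m, j <- iota 1 n].

Section Tableaux.

(* A diagram is given by the duplicate-free list of its cells. *)
Variable shape : seq cell.

Implicit Types (t : {ffun seq_sub shape -> 'I_(size shape)})
  (c d : seq_sub shape).

(* t takes its values in 0..N-1, with N the size of the shape; the entry of the
   tableau is shifted by one, so as to lie in 1..N. *)
Definition entry t c : nat := (t c).+1.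

Definition bijective_filling t : bool :=
  injectiveb t && [forall v, v \in codom t].

Definition row_increasing t : bool :=
  [forall c, forall d,
    ((val c).1 == (val d).1) && ((val c).2 < (val d).2)
      ==> (entry t c < entry t d)].

Definition column_increasing t : bool :=
  [forall c, forall d,
    ((val c).2 == (val d).2) && ((val c).1 < (val d).1)
      ==> (entry t c < entry t d)].

Definition SYT : {set {ffun seq_sub shape -> 'I_(size shape)}} :=
  [set t | [&& bijective_filling t, row_increasing t & column_increasing t]].

End Tableaux.

(* Main.v *)
Require Import Defs.
From Stdlib Require Import NArith.
From mathcomp Require Import all_boot.

Set Implicit Arguments.
Unset Strict Implicit.
Unset Printing Implicit Defensive.

(** A standard tableau is a linear extension of its shape: listing the cells in
    the order of their entries gives a bijection between tableaux and the
    enumerations of the cells in which no cell comes before one to its left or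
    above it ([card_SYT]).  Linear extensions are counted by choosing their
    first element, a minimal cell, and then enumerating the cells that are left
    ([nlinextsE]).

    In a battery shape the cells left over at each stage are described by how
    far each row has been filled.  The extra cell is treated as a row 0 whose
    filling level is k - 1 as long as that cell is present, and n afterwards;
    then the levels p >= l_1 >= ... >= l_m always decrease weakly from top to
    bottom, and the minimal cells are the extra cell, while present, and the
    cells just right of a level l_i that is smaller than the level above
    ([minimal_remaining]).  This yields a recursion that counts lattice paths
    ([nremainingE]).

    For the 7 x 11 rectangle there are 31824 states with p = 11 and 792 with
    p = 5.  They are evaluated by dynamic programming on tables, nested lists
    indexed by l_1, then l_2, and so on: [propagate] fills a table by adding,
    for each index that can grow, the whole subtable reached by that growth, so
    that no state is ever looked up by its key.  Its correctness is
    [propagate_tabulate]; the resulting formula [card_SYT_battery] holds for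
    every battery shape, and it remains to compute one binary number. *)

(** * Linear extensions, as lists *)

Section LinearExtensions.

Variables (T : eqType) (r : rel T).
Hypothesis r_irr : irreflexive r.

Implicit Types (s u : seq T) (x : T).

Definition minimal s x := ~~ has (r^~ x) s.

Fixpoint linexts n s : seq (seq T) :=
  if n is n'.+1 then
    [seq x :: u | x <- [seq x <- s | minimal s x], u <- linexts n' (rem x s)]
  else [:: [::]].

Definition nlinexts s := size (linexts (size s) s).

(** The condition bears on all pairs of positions rather than consecutive ones,
    which is the right notion for relations that are not transitive, such as
    that between cells of a common row or column. *)
Lemma mem_linexts s u :
  (u \in linexts (size s) s) =
    perm_eq u s && pairwise (fun x y => ~~ r y x) u.
Proof.
move: {2}(size s) (erefl (size s)) => n; elim: n s u => [|n IHn] s u sz_s.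
  move/size0nil: sz_s => -> /=; rewrite inE.
  by case: u => // x u; case: (boolP (perm_eq _ _)) => // /perm_size.
rewrite sz_s; have sz_rem x : x \in s -> size (rem x s) = n.
  by move=> sx; rewrite size_rem // sz_s.
apply/allpairsPdep/andP => [[x [v [+ lin_v ->]]] | []].
  rewrite mem_filter => /andP[min_x sx].
  move: lin_v; rewrite -(sz_rem x sx) IHn ?sz_rem // => /andP[perm_v pair_v].
  split; first by rewrite (permPr (perm_to_rem sx)) perm_cons.
  rewrite pairwise_cons pair_v andbT; apply/allP => y.
  rewrite (perm_mem perm_v) => /mem_rem sy.
  by apply: contra min_x => ryx; apply/hasP; exists y.
case: u => [|x v]; first by move/perm_size; rewrite sz_s.
move=> perm_u; have sx : x \in s by rewrite -(perm_mem perm_u) mem_head.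
move: perm_u; rewrite (permPr (perm_to_rem sx)) perm_cons => perm_v.
rewrite pairwise_cons => /andP[/allP min_x pair_v]; exists x, v; split=> //.
  rewrite mem_filter sx andbT; apply/hasPn => y.
  rewrite (perm_mem (perm_to_rem sx)) inE -(perm_mem perm_v).
  by case/predU1P => [-> | /min_x //]; rewrite r_irr.
by rewrite -(sz_rem x sx) IHn ?sz_rem // perm_v.
Qed.

Lemma linexts_uniq n s : uniq s -> uniq (linexts n s).
Proof.
elim: n s => //= n IHn s uniq_s; apply: allpairs_uniq_dep.
- exact: filter_uniq.
- by move=> x _; apply/IHn/rem_uniq.
- by move=> [x u] [y v] _ _ /= [-> ->].
Qed.

(** The empty list has one linear extension although the sum over its minimal
    elements vanishes; the boolean term accounts for it. *)
Lemma nlinextsE s :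
  nlinexts s =
    (s == [::]) + \sum_(x <- [seq x <- s | minimal s x]) nlinexts (rem x s).
Proof.
case def_s: s => [|x0 s']; first by rewrite /= big_nil.
rewrite -def_s; have sz_s: size s = (size s').+1 by rewrite def_s.
have ->: s == [::] = false by rewrite def_s.
rewrite /nlinexts sz_s /= size_allpairs_dep sumnE big_map.
rewrite [LHS]big_seq [RHS]big_seq; apply: eq_bigr => x.
by rewrite mem_filter => /andP[_ sx]; rewrite size_rem // sz_s.
Qed.

End LinearExtensions.

(** * Tableaux as linear extensions *)

Definition before (c d : cell) : bool :=
  ((c.1 == d.1) && (c.2 < d.2)) || ((c.2 == d.2) && (c.1 < d.1)).

Lemma before_irr : irreflexive before.
Proof. by move=> c; rewrite /before !ltnn !andbF. Qed.

Lemma SYT_before (shape : seq cell)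
    (t : {ffun seq_sub shape -> 'I_(size shape)}) :
  reflect [/\ injective t, forall v, v \in codom t
            & forall c d, before (val c) (val d) -> t c < t d]
          (t \in SYT shape).
Proof.
rewrite inE; apply: (iffP and3P).
  case=> /andP[/injectiveP inj_t /forallP surj_t] /forallP row_t /forallP col_t.
  split=> // c d /orP[] bcd.
    by have /forallP/(_ d)/implyP/(_ bcd) := row_t c.
  by have /forallP/(_ d)/implyP/(_ bcd) := col_t c.
case=> inj_t surj_t mono_t; split.
- by apply/andP; split; [apply/injectiveP | apply/forallP].
- apply/forallP=> c; apply/forallP=> d; apply/implyP=> bcd.
  by apply: mono_t; rewrite /before bcd.
- apply/forallP=> c; apply/forallP=> d; apply/implyP=> bcd.
  by apply: mono_t; rewrite /before bcd orbT.
Qed.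

Section TableauxAsLinearExtensions.

Variable shape : seq cell.

Lemma index_lt_size (c : seq_sub shape) : index (val c) shape < size shape.
Proof. by rewrite index_mem (valP c). Qed.

(** The default value, the position of [c] in the shape itself, only serves to
    stay below the bound; it never occurs when [u] is a permutation of the
    shape. *)
Definition filling (u : seq cell) : {ffun seq_sub shape -> 'I_(size shape)} :=
  [ffun c => insubd (Ordinal (index_lt_size c)) (index (val c) u)].

Lemma fillingE u c : perm_eq u shape -> filling u c = index (val c) u :> nat.
Proof.
move=> perm_u; rewrite ffunE val_insubd ifT // -(perm_size perm_u) index_mem.
by rewrite (perm_mem perm_u) (valP c).
Qed.

Hypothesis shape_uniq : uniq shape.

Lemma filling_inj u v :
  perm_eq u shape -> perm_eq v shape -> filling u = filling v -> u = v.
Proof.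
move=> perm_u perm_v eq_uv.
apply: (@eq_from_nth _ (0, 0)).
  by rewrite (perm_size perm_u) (perm_size perm_v).
move=> i lt_i; set c := nth _ u i.
have shape_c : c \in shape by rewrite -(perm_mem perm_u) mem_nth.
have /(congr1 val) := congr1 (fun t => fun_of_fin t (SeqSub shape_c)) eq_uv.
rewrite /= !fillingE //= index_uniq ?(perm_uniq perm_u) // => ->.
by rewrite nth_index // (perm_mem perm_v).
Qed.

Lemma filling_SYT u :
  u \in linexts before (size shape) shape -> filling u \in SYT shape.
Proof.
rewrite mem_linexts; last exact: before_irr.
case/andP=> perm_u pair_u.
have mem_u (c : seq_sub shape) : val c \in u.
  by rewrite (perm_mem perm_u) (valP c).
have inj_u (c d : seq_sub shape) : index (val c) u = index (val d) u -> c = d.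
  move=> eq_cd; apply: val_inj.
  by rewrite -(nth_index (0, 0) (mem_u c)) eq_cd nth_index.
apply/SYT_before; split=> [c d /(congr1 val) | v | c d bcd].
- by rewrite /= !fillingE // => /inj_u.
- have lt_v : v < size u by rewrite (perm_size perm_u).
  have shape_v : nth (0, 0) u v \in shape.
    by rewrite -(perm_mem perm_u) mem_nth.
  apply/codomP; exists (SeqSub shape_v); apply: val_inj.
  by rewrite /= fillingE //= index_uniq ?(perm_uniq perm_u).
- rewrite !fillingE // ltnNge leq_eqVlt; apply/norP; split.
    apply: contraTneq bcd => /inj_u ->.
    by rewrite before_irr.
  apply: contraL bcd => lt_dc.
  have /(pairwiseP (0, 0)) := pair_u.
  move=> /(_ (index (val d) u) (index (val c) u)).
  by rewrite !inE !index_mem !nth_index // => /(_ (mem_u d) (mem_u c) lt_dc).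
Qed.

(** Reading the cells of a tableau by increasing entries inverts [filling]. *)
Lemma SYT_filling t :
  t \in SYT shape ->
  exists2 u, u \in linexts before (size shape) shape & t = filling u.
Proof.
case/SYT_before=> inj_t surj_t mono_t.
pose h v := val (iinv (surj_t v)).
have h_t c : h (t c) = val c by rewrite /h iinv_f.
have inj_h : injective h.
  by move=> v w /val_inj eq_vw; rewrite -(f_iinv (surj_t v)) eq_vw f_iinv.
have uniq_u : uniq (map h (enum 'I_(size shape))).
  by rewrite map_inj_uniq // enum_uniq.
have perm_u : perm_eq (map h (enum 'I_(size shape))) shape.
  apply: uniq_perm => // c; apply/mapP/idP => [[v _ ->] | shape_c].
    exact: valP.
  by exists (t (SeqSub shape_c)); rewrite ?mem_enum // h_t.
exists (map h (enum 'I_(size shape))).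
  rewrite mem_linexts ?perm_u /=; last exact: before_irr.
  rewrite pairwise_map.
  have : pairwise ltn (map val (enum 'I_(size shape))).
    rewrite val_enum_ord -sorted_pairwise ?iota_ltn_sorted //.
    exact: ltn_trans.
  rewrite pairwise_map; apply: sub_pairwise => v w /= lt_vw.
  apply: contraL lt_vw => /mono_t; rewrite !f_iinv -leqNgt.
  exact: ltnW.
apply/ffunP=> c; apply: val_inj; rewrite /= fillingE // -h_t.
by rewrite index_map // index_enum_ord.
Qed.

Theorem card_SYT : #|SYT shape| = nlinexts before shape.
Proof.
rewrite cardE /nlinexts -(size_map filling).
apply/perm_size/uniq_perm; first exact: enum_uniq.
  rewrite map_inj_in_uniq ?linexts_uniq // => u v.
  rewrite !mem_linexts; try exact: before_irr.
  by move=> /andP[perm_u _] /andP[perm_v _]; apply: filling_inj.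
move=> t; rewrite mem_enum; apply/idP/mapP => [/SYT_filling[u lin_u ->] | [u]].
  by exists u.
by move=> /filling_SYT SYT_u ->.
Qed.

End TableauxAsLinearExtensions.

(** * States of a battery shape *)

(** Here [p] is the filling level of the top row and [l] those of the other
    rows; [i] counts the latter from 0, so that its entry in [p :: l] is the
    level of the row above. *)
Definition grows p l i := nth 0 l i < nth 0 (p :: l) i.

Definition fits m p l := (size l == m) && path geq p l.

Section Remaining.

Variables m n k : nat.

Lemma mem_battery c :
  (c \in battery m n k) =
    (c == (0, k)) || [&& 0 < c.1, c.1 <= m, 0 < c.2 & c.2 <= n].
Proof.
rewrite inE; congr (_ || _); case: c => i j /=.
apply/allpairsP/idP => [[[i' j'] []] | /and4P[i_gt0 le_im j_gt0 le_jn]].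
  rewrite !mem_iota !add1n !ltnS => /andP[? ?] /andP[? ?] [-> ->].
  exact/and4P.
by exists (i, j); rewrite !mem_iota !add1n !ltnS i_gt0 j_gt0.
Qed.

Lemma battery_uniq : uniq (battery m n k).
Proof.
rewrite /= allpairs_uniq ?iota_uniq ?andbT //; last by move=> [? ?] [].
apply/allpairsP => -[[i j] []]; rewrite mem_iota => + _ [/esym i0 _].
by rewrite i0.
Qed.

(** Row 0 has the cell (0, k) only, so that the levels k.-1 and n of that row
    mean that it is still present, or already used. *)
Definition remaining p l :=
  [seq c <- battery m n k | nth 0 (p :: l) c.1 < c.2].

Definition nremaining p l := nlinexts before (remaining p l).

Lemma remaining0 : 0 < k -> remaining k.-1 (nseq m 0) = battery m n k.
Proof.
move=> k_gt0; apply/all_filterP/allP => -[[|i] j].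
  by rewrite mem_battery => /orP[/eqP[->] | //] /=; rewrite prednK.
by rewrite mem_battery xpair_eqE /= nth_nseq if_same => /and3P[].
Qed.

Lemma mem_remaining_row p l i j :
  ((i.+1, j) \in remaining p l) = [&& i < m, 0 < j, j <= n & nth 0 l i < j].
Proof. by rewrite mem_filter mem_battery xpair_eqE /= andbC -!andbA. Qed.

Lemma mem_remaining_top p l j :
  ((0, j) \in remaining p l) = (j == k) && (p < k).
Proof.
rewrite mem_filter mem_battery xpair_eqE /= orbF andbC.
by case: eqP => // ->.
Qed.

Lemma fits_nth_anti p l i j :
  fits m p l -> i <= j <= m -> nth 0 (p :: l) j <= nth 0 (p :: l) i.
Proof.
move=> /andP[/eqP sz_l sorted_l] /andP[le_ij le_jm].
have geq_trans : transitive geq.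
  by move=> a b c /= ab ca; apply: leq_trans ca ab.
have := @sorted_leq_nth _ geq geq_trans leqnn 0 (p :: l) sorted_l i j.
by apply=> //; rewrite inE /= ltnS sz_l ?(leq_trans le_ij).
Qed.

Hypotheses (k_gt0 : 0 < k) (le_kn : k <= n).

Lemma top_le p : p \in [:: k.-1; n] -> p <= n.
Proof.
rewrite !inE => /orP[] /eqP-> //.
by apply: leq_trans le_kn; apply: leq_pred.
Qed.

Lemma remaining_eq0 p l :
  fits m p l -> p <= n -> (remaining p l == [::]) = (k <= p) && all (pred1 n) l.
Proof.
move=> fit_l le_pn; have /andP[/eqP sz_l _] := fit_l.
apply/eqP/andP => [rem0 | [le_kp /all_pred1P eq_l]].
  split.
    have := mem_remaining_top p l k.
    by rewrite rem0 eqxx ltnNge => /esym/negbFE.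
  apply/(all_nthP 0) => i lt_i /=; rewrite eqn_leq.
  have := mem_remaining_row p l i n; rewrite rem0 -sz_l lt_i leqnn.
  rewrite (leq_trans k_gt0 le_kn) /= ltnNge => /esym/negbFE ->; rewrite andbT.
  apply: leq_trans le_pn.
  by apply: (@fits_nth_anti p l 0 i.+1); rewrite //= -sz_l.
apply/eqP; rewrite -size_eq0 -leqn0 leqNgt -has_predT; apply/hasPn => -[[|i] j].
  by rewrite mem_remaining_top ltnNge le_kp andbF.
rewrite mem_remaining_row eq_l nth_nseq sz_l => /and4P[-> _ le_jn].
by rewrite ltnNge le_jn.
Qed.

Definition next_cell l i : cell := (i.+1, (nth 0 l i).+1).

(** Either the extra cell is present, hence minimal, or row [i.+1] offers the
    cell next to its level, which is minimal when no cell of the same column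
    remains above it; since the levels decrease it suffices to look at the row
    above.  This includes the first row of the rectangle: when its level is
    k.-1, growing is blocked by the top level k.-1 precisely as long as the
    cell (0, k) remains. *)
Lemma minimal_remaining p l :
    fits m p l -> p \in [:: k.-1; n] ->
  perm_eq [seq c <- remaining p l | minimal before (remaining p l) c]
    ([seq (0, k) | _ <- nseq (p < k) tt]
       ++ [seq next_cell l i | i <- iota 0 m & grows p l i]).
Proof.
move=> fit_l p_val.
have le_pn := top_le p_val.
apply: uniq_perm.
- by rewrite !filter_uniq // battery_uniq.
- rewrite cat_uniq (@map_inj_uniq _ _ (next_cell l)); last by move=> i j [].
  rewrite filter_uniq ?iota_uniq // andbT; case: (p < k) => //=.
    by apply/hasPn => _ /mapP[i _ ->].
  by apply/hasPn.
move=> c; rewrite mem_filter mem_cat; apply/andP/orP.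
  case: c => [[|i] j] [min_c].
    rewrite mem_remaining_top => /andP[/eqP-> lt_pk]; left.
    by rewrite lt_pk mem_head.
  rewrite mem_remaining_row => /and4P[lt_im j_gt0 le_jn lt_lj]; right.
  (* A larger j would leave the cell next to the level to the left of it. *)
  have def_j : j = (nth 0 l i).+1.
    apply/eqP; rewrite eqn_leq lt_lj andbT leqNgt.
    apply: contra min_c => lt_lj'; apply/hasP; exists (i.+1, (nth 0 l i).+1).
      rewrite mem_remaining_row lt_im ltnSn andbT /=.
      exact: leq_trans (ltnW lt_lj') le_jn.
    by rewrite /before /= eqxx lt_lj'.
  apply/mapP; exists i; last by rewrite /next_cell -def_j.
  rewrite mem_filter mem_iota add0n lt_im !andbT /grows.
  rewrite ltnNge; apply: contra min_c => le_Li.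
  (* If row i.+1 cannot grow, the cell above (i.+1, j) remains: the extra cell
     for the first row of the rectangle, and (i, j) for the others. *)
  case: i lt_im lt_lj def_j le_Li => [|i] lt_im lt_lj def_j le_Li.
    have def_p : p = nth 0 l 0.
      apply/eqP; rewrite eqn_leq le_Li.
      exact: (@fits_nth_anti p l 0 1).
    have lt_pn : p < n by rewrite def_p -def_j.
    move: p_val; rewrite !inE (ltn_eqF lt_pn) orbF => /eqP def_k.
    apply/hasP; exists (0, k).
      by rewrite mem_remaining_top eqxx def_k prednK /=.
    by rewrite /before /= def_j -def_p def_k prednK // eqxx.
  apply/hasP; exists (i.+1, j).
    by rewrite mem_remaining_row (ltnW lt_im) j_gt0 le_jn def_j ltnS.
  by rewrite /before /= eqxx ltnSn orbT.
case=> [|/mapP[i]].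
  case lt_pk: (p < k) => //=; rewrite inE => /eqP->.
  rewrite mem_remaining_top eqxx lt_pk; split=> //.
  apply/hasPn => -[[|i] j] /=; last by rewrite /before /= andbF.
  by rewrite mem_remaining_top => /andP[/eqP-> _]; rewrite before_irr.
rewrite mem_filter mem_iota add0n => /andP[grows_i /andP[_ lt_im]] ->; split.
  apply/hasPn => -[i' j'] rem_c; rewrite /before /= negb_or; apply/andP.
  move: rem_c; rewrite mem_filter => /andP[/= rem_c _].
  split; apply/negP => /andP[/eqP eq_c].
    by rewrite eq_c /= in rem_c; rewrite ltnNge rem_c.
  rewrite ltnS => le_i'i; move: rem_c; rewrite eq_c ltnNge => /negP[].
  apply: leq_trans grows_i _; apply: fits_nth_anti => //.
  by rewrite le_i'i ltnW.
rewrite mem_remaining_row lt_im leqnn /= andbT.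
apply: leq_trans grows_i _; apply: leq_trans le_pn.
by apply: (@fits_nth_anti p l 0 i) => //=; apply: ltnW.
Qed.

Lemma rem_next_cell p l i :
  rem (next_cell l i) (remaining p l) = remaining p (incr_nth l i).
Proof.
rewrite rem_filter ?filter_uniq ?battery_uniq // -filter_predI.
apply: eq_filter => -[[|i'] j] //=.
rewrite nth_incr_nth /next_cell xpair_eqE eqSS.
by case: (eqVneq i' i) => [->|_] //=; rewrite add1n [RHS]ltn_neqAle eq_sym.
Qed.

Lemma rem_top p l : p < k -> rem (0, k) (remaining p l) = remaining n l.
Proof.
move=> lt_pk; rewrite rem_filter ?filter_uniq ?battery_uniq // -filter_predI.
apply: eq_in_filter => -[[|i] j] //; rewrite mem_battery /= orbF => /eqP[->].
by rewrite /= eqxx [n < k]ltnNge le_kn.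
Qed.

(** The recursion on states.  The first term collects what does not come from
    growing a row of the rectangle: either the extra cell is used, or the state
    may be the final one. *)
Lemma nremainingE p l :
    fits m p l -> p \in [:: k.-1; n] ->
  nremaining p l =
    (if p < k then nremaining n l else (all (pred1 n) l : nat))
    + \sum_(i <- iota 0 m | grows p l i) nremaining p (incr_nth l i).
Proof.
move=> fit_l p_val; have le_pn := top_le p_val.
rewrite {1}/nremaining nlinextsE.
rewrite (perm_big _ (minimal_remaining fit_l p_val)) /=.
rewrite big_cat /= !big_map remaining_eq0 // [k <= p]leqNgt big_filter addnA.
congr (_ + _); last by apply: eq_bigr => i _; rewrite rem_next_cell.
by case: ifP => lt_pk /=; rewrite ?big_nil ?addn0 // big_seq1 rem_top.
Qed.

End Remaining.

(** * Arithmetic of binary numbers *)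

Lemma nat_of_add_bin (a b : N) : N.add a b = a + b :> nat.
Proof. by case: a b => [|a] [|b] //=; rewrite ?addn0 ?nat_of_add_pos. Qed.

Lemma nat_of_mul_bin (a b : N) : N.mul a b = a * b :> nat.
Proof. by case: a b => [|a] [|b] //=; rewrite ?muln0 ?nat_of_mul_pos. Qed.

Lemma nat_of_exp_bin (a b : N) : N.pow a b = a ^ b :> nat.
Proof.
elim/N.peano_ind: b => [|b IHb]; first by rewrite N.pow_0_r.
rewrite N.pow_succ_r' nat_of_mul_bin IHb -N.add_1_l nat_of_add_bin.
by rewrite add1n expnS.
Qed.

(** * Dynamic programming on tables *)

Fixpoint table k : Type := if k is k'.+1 then seq (table k') else N.

(** The values of [f] at the lists p >= l_1 >= ... >= l_k, by decreasing l_1,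
    then by decreasing l_2, and so on. *)
Fixpoint tabulate k p (f : seq nat -> nat) : table k :=
  match k with
  | 0 => bin_of_nat (f [::])
  | k'.+1 => [seq tabulate k' v (fun l => f (v :: l)) | v <- rev (iota 0 p.+1)]
  end.

Fixpoint add_table k : table k -> table k -> table k :=
  match k with
  | 0 => N.add
  | k'.+1 => fun X Y => [seq @add_table k' xy.1 xy.2 | xy <- zip X Y]
  end.

(** Tables list larger indices first, so that lowering the bound on the first
    index by one drops the head. *)
Definition lower_bound k : table k -> table k :=
  if k is k'.+1 then behead else id.

(** Turns the table of [f] into that of the solution [g] of
    g l = f l + sum of g (l with one index increased within its bound).
    The subtable of [g] at first index v is the solution of the same problem
    with one index less, where the source is the subtable of [f] at v plus, for
    the increase of the first index, the subtable of [g] at v + 1 that has just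
    been computed, restricted to second indices at most v. *)
Fixpoint propagate k : table k -> table k :=
  match k with
  | 0 => id
  | k'.+1 => fun X =>
    if X is x :: X' then
      let y := @propagate k' x in
      y :: scanl (fun y x => propagate (add_table x (lower_bound y))) y X'
    else [::]
  end.

(** The value at the list of zeros, stored last. *)
Fixpoint corner k : table k -> N :=
  match k with
  | 0 => id
  | k'.+1 => fun X => last 0%num [seq @corner k' x | x <- X]
  end.

Lemma rev_iotaS v : rev (iota 0 v.+1) = v :: rev (iota 0 v).
Proof. by rewrite -addn1 iotaD rev_cat. Qed.

Lemma add_tabulate k p f g :
  add_table (tabulate k p f) (tabulate k p g)
    = tabulate k p (fun l => f l + g l).
Proof.
elim: k p f g => [|k IHk] p f g /=.
  by apply: (can_inj nat_of_binK); rewrite nat_of_add_bin !bin_of_natK.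
elim: (rev _) => //= v s ->; congr (_ :: _).
exact: IHk.
Qed.

Lemma lower_tabulate k p f :
  lower_bound (tabulate k p.+1 f) = tabulate k p f.
Proof. by case: k => // k; rewrite /tabulate -/tabulate rev_iotaS. Qed.

Lemma iter_lower_tabulate k p q f :
  p <= q -> iter (q - p) (@lower_bound k) (tabulate k q f) = tabulate k p f.
Proof.
move=> /subnKC {2}<-; move: (q - p) => d.
elim: d p => [|d IHd] p; first by rewrite addn0.
by rewrite /= -addSnnS IHd lower_tabulate.
Qed.

Lemma corner_tabulate k p f :
  corner (tabulate k p f) = bin_of_nat (f (nseq k 0)).
Proof.
elim: k p f => //= k IHk p f.
by rewrite -map_comp /= rev_cons map_rcons last_rcons /= IHk.
Qed.

(** Growing [v :: l] either grows its first index, which is bounded by [p], or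
    grows [l], whose first index is bounded by [v]. *)
Lemma sum_grows k p v l (g : seq nat -> nat) :
  \sum_(i <- iota 0 k.+1 | grows p (v :: l) i) g (incr_nth (v :: l) i) =
    (if v < p then g (v.+1 :: l) else 0)
    + \sum_(i <- iota 0 k | grows v l i) g (v :: incr_nth l i).
Proof.
rewrite /= big_cons -[1]/(1 + 0) iotaDl big_map.
by rewrite {1}/grows /=; case: ifP.
Qed.

Lemma propagate_tabulate k p f g :
    (forall l, fits k p l ->
       g l = f l + \sum_(i <- iota 0 k | grows p l i) g (incr_nth l i)) ->
  propagate (tabulate k p f) = tabulate k p g.
Proof.
elim: k p f g => [|k IHk] p f g g_eq.
  by rewrite /= g_eq // big_nil addn0.
have g_eqS v l : v <= p -> fits k v l ->
    g (v :: l) = f (v :: l) + (if v < p then g (v.+1 :: l) else 0)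
      + \sum_(i <- iota 0 k | grows v l i) g (v :: incr_nth l i).
  move=> le_vp /andP[sz_l path_l]; rewrite g_eq; last by apply/and3P.
  by rewrite sum_grows addnA.
rewrite /= rev_iotaS /=.
have ->: propagate (tabulate k p (fun l => f (p :: l)))
    = tabulate k p (fun l => g (p :: l)).
  by apply: IHk => l fit_l; rewrite g_eqS // ltnn addn0.
(* Descending from v + 1 to v, the invariant is that the last subtable computed
   is that of g at v. *)
congr (_ :: _); set next := fun y x => propagate _.
suff scan_next v : v <= p ->
    scanl next (tabulate k v (fun l => g (v :: l)))
        [seq tabulate k u (fun l => f (u :: l)) | u <- rev (iota 0 v)]
      = [seq tabulate k u (fun l => g (u :: l)) | u <- rev (iota 0 v)].
  exact: scan_next.
elim: v => [//|v IHv] lt_vp; rewrite rev_iotaS /= {1 3}/next.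
rewrite lower_tabulate add_tabulate.
rewrite (IHk _ _ (fun l => g (v :: l))) => [|l fit_l].
  by rewrite (IHv (ltnW lt_vp)).
by rewrite g_eqS ?(ltnW lt_vp) // lt_vp.
Qed.

(** * Counting battery tableaux *)

(** The first pass treats the states where the extra cell has been used; the
    second one those where it is present.  Using it, when the top level jumps
    from k.-1 to n, keeps the other levels unchanged: the source of the second
    pass is the outcome of the first one, restricted to levels at most k.-1. *)
Definition battery_count m n k : N :=
  let full := propagate (tabulate m n (fun l => all (pred1 n) l)) in
  corner (propagate (iter (n - k.-1) (@lower_bound m) full)).

Theorem card_SYT_battery m n k :
  0 < k <= n -> #|SYT (battery m n k)| = battery_count m n k.
Proof.
move=> /andP[k_gt0 le_kn]; rewrite card_SYT ?battery_uniq //.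
rewrite /battery_count.
rewrite (propagate_tabulate (g := nremaining m n k n)); last first.
  move=> l fit_l; rewrite nremainingE ?inE ?eqxx ?orbT //.
  by rewrite [n < k]ltnNge le_kn.
rewrite iter_lower_tabulate ?(leq_trans (leq_pred k)) //.
rewrite (propagate_tabulate (g := nremaining m n k k.-1)); last first.
  by move=> l fit_l; rewrite nremainingE ?prednK ?leqnn // mem_head.
by rewrite corner_tabulate bin_of_natK /nremaining remaining0.
Qed.

Theorem mainTheorem2 :
  #|SYT (battery 7 11 6)| =
    2 ^ 5 * 3 ^ 2 * 5 ^ 2 * 11 * 13 * 17 ^ 2 * 19 ^ 3 * 23 ^ 2 * 29 * 31
    * 37 ^ 2 * 41 * nat_of_bin 3361178017%num * nat_of_bin 2839893182041%num.
Proof.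
(* The factors are multiplied in binary, as the numbers at hand are far too
   large to be computed in unary. *)
rewrite (@card_SYT_battery 7 11 6 isT).
have ->: battery_count 7 11 6 =
    (2 ^ 5 * 3 ^ 2 * 5 ^ 2 * 11 * 13 * 17 ^ 2 * 19 ^ 3 * 23 ^ 2 * 29 * 31
    * 37 ^ 2 * 41 * 3361178017 * 2839893182041)%num.
  by vm_compute.
rewrite !nat_of_mul_bin !nat_of_exp_bin.
exact: erefl.
Qed.
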